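(* There exists an $N$-node graph such that any embedding of it into an $N$-node $2$-dimensional grid with edge-congestion $1$ has a dilation of $\Theta(N)$.
   Context: Write $[\ell]=\{1,\ldots,\ell\}$. A $2$-dimensional grid is, for positive integers $\ell_1,\ell_2$, the graph with node set $[\ell_1]\times[\ell_2]$ in which two nodes are adjacent iff they differ by exactly $1$ in one coordinate and agree in the other; it is an $N$-node grid if $\ell_1\ell_2=N$. An embedding of a graph $G$ into a graph $H$ is a pair $\langle\phi,\rho\rangle$ where $\phi$ is a one-to-one mapping from the nodes of $G$ to the nodes of $H$ and $\rho$ maps each edge $(u,v)$ of $G$ (identified with the pair $(\phi(u),\phi(v))$) onto a set of edges of $H$ inducing a path connecting $\phi(u)$ and $\phi(v)$. The dilation of the embedding is the maximum, over edges of $G$, of the number of edges in the assigned path. The edge-congestion of the embedding is the maximum, over edges $e'$ of $H$, of the number of edges of $G$ whose assigned path contains $e'$. *)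

(* Defs.v *)
From mathcomp Require Import all_boot.
Set Implicit Arguments.
Unset Strict Implicit.
Unset Printing Implicit Defensive.

Record sgraph := SGraph {
  vertex :> finType;
  adj : rel vertex;
  adj_sym : symmetric adj;
  adj_irrefl : irreflexive adj
}.

(* An undirected edge is the two-element set of its endpoints. *)
Definition edges (G : sgraph) : {set {set G}} :=
  [set [set z.1; z.2] | z : G * G & adj z.1 z.2].

Section Grid.
Variables l1 l2 : nat.

Definition differ_by_one (i j : nat) : bool := (i.+1 == j) || (j.+1 == i).

Definition grid_adj : rel ('I_l1 * 'I_l2) := fun u v =>
  (differ_by_one u.1 v.1 && (u.2 == v.2)) ||
  ((u.1 == v.1) && differ_by_one u.2 v.2).

Lemma grid_adj_sym : symmetric grid_adj.
Proof.
move=> u v; rewrite /grid_adj /differ_by_one.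
by rewrite [u.1 == _]eq_sym [u.2 == _]eq_sym orbC [X in _ || X && _]orbC orbC
  [X in _ || _ && X]orbC.
Qed.

Lemma grid_adj_irrefl : irreflexive grid_adj.
Proof. by move=> u; rewrite /grid_adj /differ_by_one !gtn_eqF // andbF. Qed.

(* The coordinates run over {0, ..., l - 1} instead of {1, ..., l}. *)
Definition grid : sgraph := SGraph grid_adj_sym grid_adj_irrefl.

End Grid.

Definition walk_edges (H : sgraph) (x : H) (p : seq H) : {set {set H}} :=
  [set e in pairmap (fun a b => [set a; b]) x p].

(* The edge set S is that of a simple path from x to y; the vertex sequence of
   the path is x :: p. *)
Definition induces_path (H : sgraph) (x y : H) (S : {set {set H}}) : Prop :=
  exists p : seq H,
    [/\ path (@adj H) x p, last x p = y, uniq (x :: p) & S = walk_edges x p].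

(* Only the values of rho on edges of G are constrained and used. *)
Record embedding (G H : sgraph) := Embedding {
  phi : G -> H;
  rho : {set G} -> {set {set H}};
  phi_inj : injective phi;
  rho_path : forall u v : G,
    adj u v -> induces_path (phi u) (phi v) (rho [set u; v])
}.

Definition dilation (G H : sgraph) (E : embedding G H) : nat :=
  \max_(e in edges G) #|rho E e|.

Definition edge_congestion (G H : sgraph) (E : embedding G H) : nat :=
  \max_(f in edges H) #|[set e in edges G | f \in rho E e]|.

(* Main.v *)
Require Import Defs.
From mathcomp Require Import all_boot all_order all_algebra.
From mathcomp Require Import zify.
Import Order.TTheory GRing.Theory Num.Theory.

(** For a prime [p] and [N = 3 p], take the [3 x p] grid, keep the columns and
    the middle row, and join the two ends of the top row by one extra edge.
    The [p - 2] inner vertices of the middle row have degree 4.  With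
    congestion 1, a vertex of degree 4 can only be placed on an inner vertex of
    the host grid, and it then occupies all four edges there, so no foreign
    path runs through it.  As [p] is prime, the host is [3 x p] (up to
    transposition) or [1 x N], and the latter has no inner vertex; hence the
    degree 4 vertices fill the inner part of the middle row, and neighbours
    there are neighbours in the guest graph.  Their order is thus preserved, so
    the first and the last one are [p - 3] columns apart, although they are
    joined by 5 edges through the extra edge.  For all other [N] the edgeless
    graph will do, since its embeddings have congestion 0. *)

Set Implicit Arguments.
Unset Strict Implicit.
Unset Printing Implicit Defensive.

(** * Degrees, and edges as two-element sets *)

Definition degree (G : sgraph) (u : G) : nat := #|[set v | adj u v]|.

Lemma adj_neq (G : sgraph) (u v : G) : adj u v -> u != v.
Proof. by apply: contraTneq => ->; rewrite adj_irrefl. Qed.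

Lemma edgesP (G : sgraph) (e : {set G}) :
  reflect (exists u v : G, adj u v /\ e = [set u; v]) (e \in edges G).
Proof.
apply: (iffP imsetP) => [[z zA ->]|[u [v [uv ->]]]].
  by exists z.1, z.2; rewrite inE in zA.
by exists (u, v); rewrite ?inE.
Qed.

Lemma mem_edges (G : sgraph) (u v : G) : adj u v -> [set u; v] \in edges G.
Proof. by move=> uv; apply/edgesP; exists u, v. Qed.

Lemma set2_eq (T : finType) (a b c d : T) :
  [set a; b] = [set c; d] -> (a = c /\ b = d) \/ (a = d /\ b = c).
Proof.
move=> eq_S.
have: a \in [set c; d] by rewrite -eq_S set21.
have: b \in [set c; d] by rewrite -eq_S set22.
have: c \in [set a; b] by rewrite eq_S set21.
have: d \in [set a; b] by rewrite eq_S set22.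
by rewrite !inE; do 4 case/orP=> /eqP ?; subst; auto.
Qed.

(** * Edge sets of walks and simple paths *)

Section Walks.
Variable H : sgraph.
Implicit Types (x y : H) (p : seq H).

Lemma walk_edges_cons x y p :
  walk_edges x (y :: p) = [set x; y] |: walk_edges y p.
Proof. by apply/setP => e; rewrite !inE. Qed.

Lemma walk_edges_sub x p e : e \in walk_edges x p -> e \subset x :: p.
Proof.
elim: p x => [|y p IHp] x; first by rewrite inE.
rewrite walk_edges_cons in_setU1 => /predU1P[->|/IHp/subsetP e_sub].
  by apply/subsetP => z; rewrite !inE => /orP[]/eqP->; rewrite eqxx ?orbT.
by apply/subsetP => z /e_sub zp; rewrite inE zp orbT.
Qed.

Lemma walk_edges_adj x p e :
  path (@adj H) x p -> e \in walk_edges x p -> e \in edges H.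
Proof.
elim: p x => [|y p IHp] x; first by rewrite inE.
rewrite walk_edges_cons in_setU1 /= => /andP[xy yp] /predU1P[->|]; last exact: IHp.
exact: mem_edges.
Qed.

Lemma card_walk_edges x p : uniq (x :: p) -> #|walk_edges x p| = size p.
Proof.
elim: p x => [|y p IHp] x.
  by move=> _; apply/eqP; rewrite cards_eq0; apply/eqP/setP=> e; rewrite !inE.
rewrite walk_edges_cons => /= /andP[xyp /IHp IH].
rewrite cardsU1 IH.
suff -> : [set x; y] \notin walk_edges y p by [].
apply: contra xyp => /walk_edges_sub/subsetP; apply; exact: set21.
Qed.

Lemma walk_edges_rcons x p y :
  walk_edges x (rcons p y) = [set last x p; y] |: walk_edges x p.
Proof.
elim: p x => [|z p IHp] x /=; first by rewrite walk_edges_cons.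
by rewrite !walk_edges_cons IHp setUCA.
Qed.

Lemma walk_edges_rev x p :
  walk_edges (last x p) (rev (belast x p)) = walk_edges x p.
Proof.
elim: p x => [//|y p IHp] x.
rewrite /= rev_cons walk_edges_rcons IHp walk_edges_cons; congr (_ |: _).
rewrite setUC; congr ([set _] :|: [set _]).
by case: p {IHp} => //= z p; rewrite rev_cons last_rcons.
Qed.

(** Guest edges are unordered, whereas a path for an edge may have been built in one direction only;
    reversing the vertex sequence supplies the other. *)
Lemma induces_path_sym x y S : induces_path x y S -> induces_path y x S.
Proof.
case=> p [xp last_p uniq_p ->]; exists (rev (belast x p)); split.
- by rewrite -last_p rev_path; apply: sub_path xp => a b; rewrite adj_sym.
- by case: p {xp uniq_p} last_p => //= z p _; rewrite rev_cons last_rcons.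
- by rewrite -last_p -rev_rcons -lastI rev_uniq.
- by rewrite -last_p walk_edges_rev.
Qed.

End Walks.

(** * Dilation bounds, and embeddings of congestion at most 1 *)

Section Embedding.
Variables (G H : sgraph) (E : embedding G H).

Lemma rho_edges e f : e \in edges G -> f \in rho E e -> f \in edges H.
Proof.
case/edgesP=> u [v [uv ->]]; case: (rho_path E uv) => p [xp _ _ ->].
exact: walk_edges_adj xp.
Qed.

(** A simple path has fewer edges than the host has vertices. This is the upper half of the linear
    bound. *)
Lemma dilation_le_card : dilation E <= #|H|.
Proof.
apply/bigmax_leqP => e /edgesP[u [v [uv ->]]].
case: (rho_path E uv) => p [_ _ p_uniq ->]; rewrite card_walk_edges //.
apply: ltnW; rewrite -[(size p).+1]/(size (phi E u :: p)).
by rewrite -(card_uniqP p_uniq) max_card.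
Qed.

Lemma lipschitz_path (f : H -> nat) x p :
  (forall y z, adj y z -> f y <= (f z).+1) ->
  path (@adj H) x p -> f x <= f (last x p) + size p.
Proof.
move=> f_lip; elim: p x => [|y p IHp] x /=; first by rewrite addn0.
by case/andP=> /f_lip xy /IHp; lia.
Qed.

(** Here [f] stands for a grid coordinate, which changes by at most 1 along each edge of the routing
    path. *)
Lemma lipschitz_dilation (f : H -> nat) u v :
  (forall y z, adj y z -> f y <= (f z).+1) ->
  adj u v -> f (phi E u) <= f (phi E v) + dilation E.
Proof.
move=> f_lip uv; have := rho_path E uv => -[p [xp last_p p_uniq rho_uv]].
apply: leq_trans (lipschitz_path f_lip xp) _; rewrite last_p leq_add2l.
rewrite -(card_walk_edges p_uniq) -rho_uv.
exact: leq_bigmax_cond (mem_edges uv).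
Qed.

Hypothesis congE : edge_congestion E <= 1.

Lemma congestion1_inj e1 e2 f : e1 \in edges G -> e2 \in edges G ->
  f \in rho E e1 -> f \in rho E e2 -> e1 = e2.
Proof.
move=> e1G e2G f1 f2; have fH := rho_edges e1G f1.
have /bigmax_leqP/(_ f fH)/card_le1_eqP := congE; apply; by rewrite inE ?e1G ?e2G.
Qed.

(** The vertex after [phi E u] on the path of [uv]; the path being simple, it is unique. For
    adjacent [u] and [v] the default is never taken: [phi E] is injective, so the path has an
    edge. *)
Let exit u v : H :=
  odflt (phi E u) [pick y | [set phi E u; y] \in rho E [set u; v]].

Let exitP u v : adj u v ->
  [set phi E u; exit u v] \in rho E [set u; v] /\ adj (phi E u) (exit u v).
Proof.
move=> uv.
suff ruv : [set phi E u; exit u v] \in rho E [set u; v].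
  split=> //; have /edgesP[a [b [ab]]] := rho_edges (mem_edges uv) ruv.
  by case/set2_eq=> -[-> ->] //; rewrite adj_sym.
rewrite /exit; case: pickP => //= none.
case: (rho_path E uv) => -[|y p] [_ last_p _ rho_uv].
  by have := adj_neq uv; rewrite (phi_inj last_p) eqxx.
by have := none y; rewrite rho_uv walk_edges_cons setU11.
Qed.

(** Two guest edges at [u] with the same exit would share a host edge. *)
Let exit_inj u : {in [set v | adj u v] &, injective (exit u)}.
Proof.
move=> v w; rewrite !inE => uv uw vw.
have [rv _] := exitP uv; have [rw _] := exitP uw; rewrite -vw in rw.
case/set2_eq: (congestion1_inj (mem_edges uv) (mem_edges uw) rv rw) => -[] //.
by move=> -> ->.
Qed.

Let exit_sub u : exit u @: [set v | adj u v] \subset [set y | adj (phi E u) y].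
Proof. by apply/subsetP => _ /imsetP[v + ->]; rewrite !inE => /exitP[]. Qed.

Lemma degree_phi u : degree u <= degree (phi E u).
Proof. by rewrite /degree -(card_in_imset (@exit_inj u)) subset_leq_card. Qed.

Let exit_surj u y : degree (phi E u) <= degree u -> adj (phi E u) y ->
  exists2 v, adj u v & y = exit u v.
Proof.
move=> sat uy.
have /eqP im : exit u @: [set v | adj u v] == [set y | adj (phi E u) y].
  by rewrite eqEcard exit_sub (card_in_imset (@exit_inj u)).
have : y \in exit u @: [set v | adj u v] by rewrite im inE.
by case/imsetP=> v; rewrite inE; exists v.
Qed.

(** By counting, the guest edges at [u] exit through all the host edges at [phi E u], and congestion
    1 leaves no room there for another guest edge. *)
Lemma saturated_incident u y e : degree (phi E u) <= degree u ->
  e \in edges G -> adj (phi E u) y -> [set phi E u; y] \in rho E e -> u \in e.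
Proof.
move=> sat eG uy ye; have [v uv yv] := exit_surj sat uy.
have [rv _] := exitP uv; rewrite -yv in rv.
by rewrite -(congestion1_inj (mem_edges uv) eG rv ye) set21.
Qed.

(** The host edge between the two images carries a guest edge at [u]; saturation at [w] forces that
    same edge to end in [w]. *)
Lemma saturated_adj u w : degree (phi E u) <= degree u ->
  degree (phi E w) <= degree w -> adj (phi E u) (phi E w) -> adj u w.
Proof.
move=> satu satw uw; have [v uv yv] := exit_surj satu uw.
have [rv _] := exitP uv; rewrite -yv setUC in rv.
have wu : adj (phi E w) (phi E u) by rewrite adj_sym.
have := saturated_incident satw (mem_edges uv) wu rv.
rewrite !inE => /orP[]/eqP weq; last by rewrite weq.
by have := adj_neq uw; rewrite weq eqxx.
Qed.

End Embedding.

(** * The guest graph *)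

Section DoubleComb.
Variable p : nat.

(** The extra edge, directed from left to right. The test [u != v] prevents a loop when [p] is 1 and
    the two ends coincide. *)
Definition long_edge (u v : 'I_3 * 'I_p) : bool :=
  [&& u != v, u.1 == 0 :> nat, v.1 == 0 :> nat, u.2 == 0 :> nat & v.2.+1 == p].

Definition comb_adj : rel ('I_3 * 'I_p) := fun u v =>
  [|| differ_by_one u.1 v.1 && (u.2 == v.2),
      [&& u.1 == 1 :> nat, v.1 == 1 :> nat & differ_by_one u.2 v.2],
      long_edge u v | long_edge v u].

Lemma comb_adj_sym : symmetric comb_adj.
Proof.
move=> u v; rewrite /comb_adj /differ_by_one.
rewrite [u.2 == _]eq_sym [_ || long_edge v u]orbC.
by rewrite [(u.1.+1 == _) || _]orbC [(u.2.+1 == _) || _]orbC andbCA.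
Qed.

Lemma comb_adj_irrefl : irreflexive comb_adj.
Proof. by move=> u; rewrite /comb_adj /differ_by_one /long_edge !eqxx; lia. Qed.

Definition comb : sgraph := SGraph comb_adj_sym comb_adj_irrefl.

End DoubleComb.

(** * The lower bound on the dilation, for an abstract host *)

Section CombDilation.
Variable m : nat.
Local Notation comb := (comb m.+2).

(** The shift by one skips the left end of the middle row; the right end lies beyond the last
    index. *)
Definition spine (i : 'I_m) : comb := (inord 1, inord i.+1).

Lemma spine_inj : injective spine.
Proof.
move=> i j [] /(congr1 val); rewrite /= !inordK; try by lia.
  by move=> /eqP; rewrite eqSS => /eqP/val_inj.
all: have := ltn_ord i; have := ltn_ord j; lia.
Qed.

Lemma degree_spine i : 4 <= degree (spine i).
Proof.
have iP := ltn_ord i.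
pose s : seq comb := [:: (inord 0, inord i.+1); (inord 2, inord i.+1);
                         (inord 1, inord i); (inord 1, inord i.+2)].
rewrite /degree cardE; apply: (@uniq_leq_size _ s).
  rewrite /= !inE !xpair_eqE -!val_eqE /= !inordK; lia.
move=> x; rewrite !inE mem_enum inE /= /comb_adj /differ_by_one.
by case/or4P=> /eqP->; rewrite /= -?val_eqE /= !inordK; lia.
Qed.

Lemma spine_adj i j : adj (spine i) (spine j) -> i <= j.+1.
Proof.
have iP := ltn_ord i; have jP := ltn_ord j.
rewrite /= /comb_adj /differ_by_one /long_edge /= -!val_eqE /= !inordK; lia.
Qed.

(** The host is abstract so that one proof serves both orientations of the grid: [col] is the
    coordinate along the long side, and the degree 4 vertices form a single row in columns 1 to
    [m]. *)
Lemma comb_dilation (H : sgraph) (E : embedding comb H) (col : H -> nat) :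
  0 < m -> edge_congestion E <= 1 ->
  (forall x y : H, adj x y -> col x <= (col y).+1) ->
  (forall x : H, degree x <= 4) ->
  (forall x : H, 4 <= degree x -> 0 < col x <= m) ->
  (forall x y : H, 4 <= degree x -> 4 <= degree y -> col x = col y -> x = y) ->
  (forall x y : H, 4 <= degree x -> 4 <= degree y -> col y = (col x).+1 ->
     adj x y) ->
  m <= (5 * dilation E).+1.
Proof.
move=> m_gt0 cong col_lip deg_le4 deg4_col deg4_inj deg4_adj.
have deg4 i : 4 <= degree (phi E (spine i)).
  exact: leq_trans (degree_spine i) (degree_phi cong _).
have colP i : 0 < col (phi E (spine i)) <= m by exact: deg4_col.
have col_lt i : (col (phi E (spine i))).-1 < m by have := colP i; lia.
(* Columns are renumbered from 0, so that [f] becomes a permutation of the spine indices. *)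
pose f i := Ordinal (col_lt i).
have f_inj : injective f.
  move=> i j /(congr1 val) /= eq_col; apply: spine_inj; apply: (phi_inj (e := E)).
  by apply: deg4_inj => //; have := colP i; have := colP j; lia.
have [g fK gK] := injF_bij f_inj.
have gS (j j' : 'I_m) : j' = j.+1 :> nat -> adj (spine (g j)) (spine (g j')).
  move=> jj'; apply: (saturated_adj cong).
  - exact: leq_trans (deg_le4 _) (degree_spine _).
  - exact: leq_trans (deg_le4 _) (degree_spine _).
  - apply: deg4_adj => //; have := congr1 val (gK j); have := congr1 val (gK j').
    by rewrite /= jj'; have := colP (g j); have := colP (g j'); lia.
(* Successive columns hold spine neighbours, whose indices differ by at most 1; so the inverse [g]
   is 1-Lipschitz. *)
have g_lip k (j j' : 'I_m) : j' = j + k :> nat ->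
    g j <= g j' + k /\ g j' <= g j + k.
  elim: k j' => [|k IHk] j' jj'.
    have -> : j' = j by apply: val_inj; rewrite /= jj' addn0.
    by rewrite addn0.
  have j1P : j + k < m by have := ltn_ord j'; lia.
  have [h1 h2] := IHk (Ordinal j1P) erefl.
  have a : adj (spine (g (Ordinal j1P))) (spine (g j')).
    by apply: gS; rewrite /= jj' addnS.
  have h3 := spine_adj a; rewrite adj_sym in a; have h4 := spine_adj a; lia.
have i0P : 0 < m by [].
have i1P : m.-1 < m by lia.
pose i0 := Ordinal i0P; pose i1 := Ordinal i1P.
(* The sum of truncated differences is the distance of the two columns. As [g] maps them to the
   indices 0 and [m.-1], they are at least that far apart. *)
have far : m.-1 <= f i0 - f i1 + (f i1 - f i0).
  case: (leqP (f i0) (f i1)) => le_f.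
    have /g_lip : f i1 = f i0 + (f i1 - f i0) :> nat by lia.
    by rewrite !fK /=; lia.
  have /g_lip : f i0 = f i1 + (f i0 - f i1) :> nat by lia.
  by rewrite !fK /=; lia.
pose c00 : comb := (inord 0, inord 0); pose c10 : comb := (inord 1, inord 0).
pose c01 : comb := (inord 0, inord m.+1); pose c11 : comb := (inord 1, inord m.+1).
have near u v : adj u v ->
    col (phi E u) <= col (phi E v) + dilation E
    /\ col (phi E v) <= col (phi E u) + dilation E.
  by move=> uv; split; apply: lipschitz_dilation => //; rewrite adj_sym.
(* The five edges behind the constant 5: along the middle row to its left end, up, across the extra
   edge, down, and back to the last spine vertex. *)
have adjs : [/\ adj (spine i0) c10, adj c10 c00, adj c00 c01, adj c01 c11
               & adj c11 (spine i1)].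
  by split; rewrite /= /comb_adj /differ_by_one /long_edge
    ?xpair_eqE /= -!val_eqE /= !inordK; lia.
case: adjs => /near n1 /near n2 /near n3 /near n4 /near n5.
move: far; rewrite /=; have := colP i0; have := colP i1; lia.
Qed.

End CombDilation.

(** * Degrees in the grid, and the possible shapes of the host *)

Section GridDegree.
Variables l1 l2 : nat.

Lemma card_differ_by_one l (i : 'I_l) :
  #|[set j : 'I_l | differ_by_one i j]| <= (0 < i) + (i.+1 < l).
Proof.
have -> : [set j : 'I_l | differ_by_one i j]
    = [set j : 'I_l | j.+1 == i] :|: [set j : 'I_l | i.+1 == j].
  by apply/setP => j; rewrite !inE orbC.
apply: leq_trans (leq_card_setU _ _) (leq_add _ _).
  case: posnP => [i0|_].
    by rewrite leqn0 cards_eq0; apply/eqP/setP => j; rewrite !inE i0.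
  by apply/card_le1_eqP => j k; rewrite !inE => /eqP ? /eqP ?; apply: val_inj => /=; lia.
case: ltnP => [_|le_l].
  by apply/card_le1_eqP => j k; rewrite !inE => /eqP ? /eqP ?; apply: val_inj => /=; lia.
rewrite leqn0 cards_eq0; apply/eqP/setP => j; rewrite !inE.
by have := ltn_ord j; lia.
Qed.

Lemma degree_grid (u : grid l1 l2) :
  degree u <= (0 < u.1) + (u.1.+1 < l1) + ((0 < u.2) + (u.2.+1 < l2)).
Proof.
have -> : degree u = #|setX [set i : 'I_l1 | differ_by_one u.1 i] [set u.2]
                  :|: setX [set u.1] [set j : 'I_l2 | differ_by_one u.2 j]|.
  congr #|pred_of_set _|; apply/setP => -[i j]; rewrite !inE /= /grid_adj /=.
  by rewrite [i == _]eq_sym [j == _]eq_sym.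
apply: leq_trans (leq_card_setU _ _) (leq_add _ _); rewrite cardsX cards1.
  by rewrite muln1 card_differ_by_one.
by rewrite mul1n card_differ_by_one.
Qed.

Lemma degree_grid_le4 (u : grid l1 l2) : degree u <= 4.
Proof. by have := degree_grid u; lia. Qed.

Lemma degree4_interior (u : grid l1 l2) : 4 <= degree u ->
  [/\ 0 < u.1, u.1.+1 < l1, 0 < u.2 & u.2.+1 < l2].
Proof.
by have := degree_grid u; split; lia.
Qed.

End GridDegree.

Lemma comb_grid_dilation m l1 l2 (E : embedding (comb m.+2) (grid l1 l2)) :
  0 < m -> prime m.+2 -> l1 * l2 = 3 * m.+2 -> edge_congestion E = 1 ->
  m <= (5 * dilation E).+1.
Proof.
move=> m_gt0 pr_p eq_l congE.
have cong : edge_congestion E <= 1 by rewrite congE.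
(* Some spine vertex exists, and its image must be an interior vertex of the host. *)
have [l1_gt1 l2_gt1] : 1 < l1 /\ 1 < l2.
  have := leq_trans (degree_spine (Ordinal m_gt0)) (degree_phi cong _).
  by case/degree4_interior => /=; split; lia.
have factor3 q l : 1 < l -> q * l = 3 -> q = 1 /\ l = 3.
  by case: q => [|[|q]]; nia.
(* The prime divides one side; its cofactor times the other side is 3, and that other side exceeds
   1. *)
have : (l1 = 3 /\ l2 = m.+2) \/ (l1 = m.+2 /\ l2 = 3).
  have : m.+2 %| l1 * l2 by rewrite eq_l dvdn_mull.
  rewrite Euclid_dvdM // => /orP[]/dvdnP[q lq]; [right | left].
    have [|q1 ->] := factor3 q l2 l2_gt1; last by rewrite lq q1 mul1n.
    by apply/eqP; rewrite -(@eqn_pmul2r m.+2) // -eq_l lq mulnAC.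
  have [|q1 ->] := factor3 q l1 l1_gt1; last by rewrite lq q1 mul1n.
  by apply/eqP; rewrite -(@eqn_pmul2r m.+2) // -eq_l lq mulnCA mulnA.
case=> -[eq1 eq2]; subst l1 l2.
  apply: (@comb_dilation _ _ E (fun u => u.2)) => //.
  - move=> x y /=; rewrite /grid_adj /differ_by_one -!val_eqE /=; lia.
  - exact: degree_grid_le4.
  - by move=> x /degree4_interior[]; lia.
  - move=> [x1 x2] [y1 y2] /degree4_interior[/= ? ? _ _] /degree4_interior[/= ? ? _ _].
    move=> /val_inj->; congr pair; apply: val_inj => /=; lia.
  - move=> x y /degree4_interior[/= ? ? _ _] /degree4_interior[/= ? ? _ _].
    rewrite /= /grid_adj /differ_by_one -!val_eqE /=; lia.
apply: (@comb_dilation _ _ E (fun u => u.1)) => //.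
- move=> x y /=; rewrite /grid_adj /differ_by_one -!val_eqE /=; lia.
- exact: degree_grid_le4.
- by move=> x /degree4_interior[]; lia.
- move=> [x1 x2] [y1 y2] /degree4_interior[/= _ _ ? ?] /degree4_interior[/= _ _ ? ?].
  move=> /val_inj->; congr pair; apply: val_inj => /=; lia.
- move=> x y /degree4_interior[/= _ _ ? ?] /degree4_interior[/= _ _ ? ?].
  rewrite /= /grid_adj /differ_by_one -!val_eqE /=; lia.
Qed.

(** * An embedding of congestion 1 into the [3 x p] grid *)

Section CombInGrid.
Variable m : nat.
Local Notation comb := (comb m.+2).
Local Notation grid := (grid 3 m.+2).

Let top (j : nat) : 'I_3 * 'I_m.+2 := (ord0, inord j).
Let top_row : seq grid := [seq top j | j <- iota 1 m.+1].
Let long : {set 'I_3 * 'I_m.+2} := [set top 0; top m.+1].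

(** The extra edge is led along the top row; all other guest edges are grid edges and stay in
    place. *)
Let route (e : {set comb}) : {set {set grid}} :=
  if e == long then walk_edges (top 0 : grid) top_row else [set e].

Let top_path :
  induces_path (top 0 : grid) (top m.+1) (walk_edges (top 0 : grid) top_row).
Proof.
exists top_row; split=> //.
- apply/(pathP (top 0)) => i; rewrite size_map size_iota => i_lt.
  rewrite -map_cons -[0 :: _]/(iota 0 m.+2) !(nth_map 0) ?size_iota //; last by lia.
  rewrite !nth_iota //; last by lia.
  by rewrite /= /grid_adj /differ_by_one /= !inordK; lia.
- by rewrite last_map -nth_last size_iota nth_iota.
- rewrite -map_cons -[0 :: _]/(iota 0 m.+2) map_inj_in_uniq ?iota_uniq // => i j.
  rewrite !mem_iota => /andP[_ i_lt] /andP[_ j_lt] [] /(congr1 val).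
  by rewrite /= !inordK.
Qed.

(** The positive first coordinate keeps every ordinary edge off the top row, hence off the
    detour. *)
Let comb_adj_cases (u v : comb) : adj u v ->
  adj (u : grid) (v : grid) /\ (0 < u.1 \/ 0 < v.1) \/ [set u; v] = long.
Proof.
have longP a b : long_edge a b -> [set a; b] = long.
  case: a b => [a1 a2] [b1 b2] /and5P[_ /= /eqP a10 /eqP b10 /eqP a20 /eqP b20].
  congr [set _; _]; congr pair; apply: val_inj => //=; rewrite inordK //; lia.
case/or4P=> [uv|uv|/longP|]; last by move=> /longP <-; right; rewrite setUC.
- left; rewrite /= /grid_adj uv; split=> //.
  by case/andP: uv; rewrite /differ_by_one; lia.
- left; rewrite /= /grid_adj -!val_eqE /=; split; move: uv; lia.
- by right.
Qed.

Let route_path (u v : comb) : adj u v ->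
  induces_path (u : grid) (v : grid) (route [set u; v]).
Proof.
move=> uv; rewrite /route; case: eqP => [/set2_eq[] [-> ->]|not_long].
- exact: top_path.
- exact: induces_path_sym top_path.
case: (comb_adj_cases uv) => [[guv _]|//]; exists [:: v]; split=> //=.
- by rewrite andbT; exact: guv.
- by rewrite inE andbT; exact: (adj_neq uv).
- by apply/setP => e; rewrite !inE.
Qed.

Definition comb_embedding : embedding comb grid :=
  @Embedding comb grid id route (@inj_id _) route_path.

Lemma comb_embedding_congestion : edge_congestion comb_embedding = 1.
Proof.
have not_top e :
    e \in edges comb -> e \in walk_edges (top 0 : grid) top_row -> e = long.
  case/edgesP=> u [v [uv ->]] /walk_edges_sub/subsetP sub.
  have top0 w : w \in [set u; v] -> w.1 = 0 :> nat.
    by move=> /sub; rewrite inE => /predU1P[->|/mapP[j _ ->]].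
  case: (comb_adj_cases uv) => // -[_]; rewrite !top0 ?set21 ?set22 //.
  by case.
apply/eqP; rewrite eqn_leq; apply/andP; split.
  apply/bigmax_leqP => f fH; apply/card_le1_eqP => e1 e2.
  rewrite !inE /= /route => /andP[e1G +] /andP[e2G +].
  case: eqP => [->|_]; case: eqP => [->|_] //.
  - by move=> f_top; rewrite in_set1 => /eqP fe; apply: not_top => //; rewrite -fe.
  - by rewrite in_set1 => /eqP fe f_top; symmetry; apply: not_top => //; rewrite -fe.
  - by rewrite !in_set1 => /eqP <- /eqP.
(* An edge of the first column shows that the congestion is not 0. *)
pose u : comb := (inord 0, inord 0); pose v : comb := (inord 1, inord 0).
have uvC : adj u v by rewrite /= /comb_adj /differ_by_one -!val_eqE /= !inordK; lia.
have uvH : adj (u : grid) (v : grid).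
  by rewrite /= /grid_adj /differ_by_one -!val_eqE /= !inordK; lia.
rewrite /edge_congestion.
apply: leq_trans (leq_bigmax_cond _ (mem_edges uvH)).
rewrite card_gt0; apply/set0Pn; exists [set u; v]; rewrite inE.
rewrite (mem_edges uvC) /= /route; case: eqP => [eq_long|_]; last by rewrite inE.
have : v \in long by rewrite -eq_long set22.
by rewrite !inE !xpair_eqE -!val_eqE /= !inordK.
Qed.

End CombInGrid.

(** * The remaining [N], and the theorem *)

Lemma edgeless_sym n : symmetric (fun _ _ : 'I_n => false).
Proof. by []. Qed.

Lemma edgeless_irrefl n : irreflexive (fun _ _ : 'I_n => false).
Proof. by []. Qed.

Definition edgeless (n : nat) : sgraph :=
  SGraph (@edgeless_sym n) (@edgeless_irrefl n).

Lemma edgeless_congestion n H (E : embedding (edgeless n) H) :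
  edge_congestion E = 0.
Proof.
apply/eqP; rewrite -leqn0; apply/bigmax_leqP => f _.
rewrite leqn0 cards_eq0; apply/eqP/setP => e; rewrite !inE.
by apply/negbTE/negP => /andP[/edgesP[u [v []]]].
Qed.

Definition comb_or_edgeless (N : nat) : sgraph :=
  if (3 %| N) && prime (N %/ 3) then comb (N %/ 3) else edgeless N.

Local Open Scope ring_scope.

Theorem theorem4 :
  exists G : nat -> sgraph,
    [/\ forall N : nat, #|vertex (G N)| = N,
        exists (c C : rat) (N0 : nat),
          [/\ 0 < c, 0 < C &
              forall N l1 l2 : nat,
                (N0 <= N)%N -> (0 < l1)%N -> (0 < l2)%N -> (l1 * l2)%N = N ->
                forall E : embedding (G N) (grid l1 l2),
                  edge_congestion E = 1%N ->
                  c * N%:R <= (dilation E)%:R /\ (dilation E)%:R <= C * N%:R]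
      & forall n : nat, exists N l1 l2 : nat,
          [/\ (n <= N)%N, (0 < l1)%N, (0 < l2)%N, (l1 * l2)%N = N &
              exists E : embedding (G N) (grid l1 l2), edge_congestion E = 1%N]].
Proof.
exists comb_or_edgeless; split.
- move=> N; rewrite /comb_or_edgeless; case: ifP => [/andP[N3 _]|_] /=.
    by rewrite card_prod !card_ord mulnC divnK.
  by rewrite card_ord.
(* With [N] equal to [3 * m.+2] and dilation [D], the bound [m <= 5 * D + 1] gives
   [N <= 15 * D + 9]. From [N >= 18] the 9 is at most half of [N], so [N <= 30 * D]. *)
- exists (30%:R^-1), 1, 18%N; split=> // N l1 l2 N_ge l1_gt0 l2_gt0 eq_N E congE.
  split; last first.
    rewrite mul1r ler_nat; apply: leq_trans (dilation_le_card E) _.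
    by rewrite /= card_prod !card_ord eq_N.
  rewrite mulrC ler_pdivrMr // -natrM ler_nat.
  move: E congE; rewrite /comb_or_edgeless.
  case: ifP => [/andP[N3 pr_p]|_] E congE; last first.
    by rewrite edgeless_congestion in congE.
  have eqN : N = (3 * (N %/ 3))%N by rewrite mulnC divnK.
  move: (N %/ 3)%N pr_p eqN E congE => [|[|m]] // pr_p eqN E congE.
  have m_gt0 : (0 < m)%N by lia.
  have := comb_grid_dilation m_gt0 pr_p (etrans eq_N eqN) congE; lia.
(* Arbitrarily large primes make the dilation bound non-vacuous for infinitely many [N]. *)
move=> n; have [p n_lt pr_p] := prime_above n.
exists (3 * p)%N, 3%N, p; split=> //; [by lia | exact: prime_gt0 |].
rewrite /comb_or_edgeless dvdn_mulr // mulKn // pr_p.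
case: p pr_p {n_lt} => [|[|m]] // _.
by exists (comb_embedding m); exact: comb_embedding_congestion.
Qed.
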